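(* Let $\mathbb{K}=\mathbb{R}$ or $\mathbb{K}=\mathbb{C}$, let $X=(\mathbb{K}^3,\|\cdot\|)$ be a three-dimensional normed space over $\mathbb{K}$ and let $Y\subseteq X$ be a two-dimensional linear subspace. If $\lambda(Y,X)>1$, then a minimal projection $P:X\to Y$ is $2$-strongly unique.
   Context: For a linear subspace $Y$ of a finite-dimensional normed space $X$, a projection $P:X\to Y$ is a linear map with $P(y)=y$ for all $y\in Y$; $\|P\|$ is the operator norm. The relative projection constant is $\lambda(Y,X)=\inf\|P\|$ over all linear projections $P:X\to Y$, and $P$ is a minimal projection if $\|P\|=\lambda(Y,X)$ (one always exists in finite dimensions). For a real $\alpha\ge1$, a projection $P:X\to Y$ is an $\alpha$-strongly unique minimal projection if there is $r>0$ such that $\|Q\|^\alpha\ge\|P\|^\alpha+r\|Q-P\|^\alpha$ for every linear projection $Q:X\to Y$. *)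

(* Defs.v *)
From HB Require Import structures.
From mathcomp Require Import all_boot all_order all_algebra.
From mathcomp Require Import complex.
From mathcomp Require Import all_classical all_reals all_analysis.

Set Implicit Arguments.
Unset Strict Implicit.
Unset Printing Implicit Defensive.

Import Order.TTheory GRing.Theory Num.Theory.

Local Open Scope classical_set_scope.
Local Open Scope ring_scope.
Local Open Scope complex_scope.

Variant scalar_kind := RealScalars | ComplexScalars.

Definition scalar_field (R : realType) (k : scalar_kind) : fieldType :=
  match k with
  | RealScalars => R : fieldType
  | ComplexScalars => R[i] : fieldType
  end.

(* The absolute value is taken in R in both cases: the library norm on R[i]
   has its values in R[i], where sup and inf are not available. *)
Definition absval (R : realType) (k : scalar_kind) : scalar_field R k -> R :=
  match k return scalar_field R k -> R with
  | RealScalars => fun a : R => `|a|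
  | ComplexScalars => fun z : R[i] => ComplexField.Normc.normc z
  end.

Section Projections.
Variables (R : realType) (k : scalar_kind).
Local Notation K := (scalar_field R k).
Variable X : vectType K.
Implicit Types (N : X -> R) (Y : {vspace X}) (P Q : 'End(X)).

Definition is_norm N : Prop :=
  [/\ forall x, N x = 0 -> x = 0,
      forall x y, N (x + y) <= N x + N y &
      forall (a : K) x, N (a *: x) = absval a * N x].

(* A linear map X -> Y is represented by the endomorphism of X obtained by
   composing it with the inclusion of Y; the operator norm is unchanged, since
   Y carries the norm of X. *)
Definition is_projection Y P : Prop :=
  (limg P <= Y)%VS /\ (forall y, y \in Y -> P y = y).

Definition opnorm N P : R := sup [set N (P x) | x in [set x | N x <= 1]].

Definition relative_projection_constant N Y : R :=
  inf [set opnorm N P | P in [set P | is_projection Y P]].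

Definition is_minimal_projection N Y P : Prop :=
  is_projection Y P /\ opnorm N P = relative_projection_constant N Y.

Definition is_strongly_unique_minimal_projection (alpha : R) N Y P : Prop :=
  is_projection Y P /\
  exists2 r : R, 0 < r &
    forall Q, is_projection Y Q ->
      opnorm N P `^ alpha + r * opnorm N (Q - P) `^ alpha
        <= opnorm N Q `^ alpha.

End Projections.

(* Main.v *)
(* Let L = ||P|| > 1, P x = x - f(x) z, and let Q = P + f(.) y be another
   projection, y in Y.  For a pair (x, g), g a functional of norm one with
   g(P x) = L, |g(Q x)|^2 = L^2 + 2 L Re (f(x) g(y)) + |f(x) g(y)|^2, and f(x) is
   bounded away from 0 because L > 1.  By minimality of P every direction y' in Y
   admits such a pair with Re (f(x) g(y')) >= 0.  Take y' = y + tau g1(z) y1, where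
   y, y1 span Y, g1 is a functional of norm one, g1(y) = 0 and g1(y1) = 1.  If |g(y)|
   is not small, the quadratic term wins.  If it is small, g is almost a multiple
   of g1 on Y, and L > 1 makes Re (f(x) g(g1(z) y1)) negative, so that
   Re (f(x) g(y)) is at least a multiple of tau.  The choice of tau proportional to
   ||y||^2 gives ||Q||^2 >= L^2 + r ||y||^2 in both cases.  Working with pairs that
   are extremal only up to epsilon avoids compactness and gives an explicit r. *)

Require Import Defs.
From HB Require Import structures.
From mathcomp Require Import all_boot all_order all_algebra.
From mathcomp Require Import complex.
From mathcomp Require Import all_classical all_reals all_analysis.
From mathcomp Require Import ring lra.

Set Implicit Arguments.
Unset Strict Implicit.
Unset Printing Implicit Defensive.

Import Order.TTheory GRing.Theory Num.Theory.
Import numFieldNormedType.Exports.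

Local Open Scope classical_set_scope.
Local Open Scope ring_scope.

(** * Scalars *)

Section Scalars.
Variable R : realType.
Implicit Type k : scalar_kind.

Definition of_real k : R -> scalar_field R k :=
  match k return R -> scalar_field R k with
  | RealScalars => fun r => r
  | ComplexScalars => fun r : R => (r%:C)%C
  end.

Definition real_part k : scalar_field R k -> R :=
  match k return scalar_field R k -> R with
  | RealScalars => fun a : R => a
  | ComplexScalars => fun a : R[i] => complex.Re a
  end.

Lemma of_real_is_additive k : {morph of_real k : a b / a - b}.
Proof. by case: k => a b //=; rewrite rmorphB. Qed.

Lemma of_real_is_multiplicative k :
  of_real k 1 = 1 /\ {morph of_real k : a b / a * b}.
Proof. by case: k; split=> // a b /=; rewrite rmorphM. Qed.

HB.instance Definition _ k :=
  GRing.isZmodMorphism.Build R (scalar_field R k) (of_real k)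
    (@of_real_is_additive k).
HB.instance Definition _ k :=
  GRing.isMonoidMorphism.Build R (scalar_field R k) (of_real k)
    (@of_real_is_multiplicative k).

Lemma real_part_is_additive k : {morph @real_part k : a b / a - b}.
Proof. by case: k => //= [] [a b] [c d]. Qed.

HB.instance Definition _ k :=
  GRing.isZmodMorphism.Build (scalar_field R k) R (@real_part k)
    (@real_part_is_additive k).

Lemma real_part_of_real k r : real_part (of_real k r) = r.
Proof. by case: k. Qed.

Lemma real_partMr k r (a : scalar_field R k) :
  real_part (of_real k r * a) = r * real_part a.
Proof. by case: k a => //= -[a b] /=; rewrite mul0r subr0. Qed.

Lemma absval_ge0 k (a : scalar_field R k) : 0 <= absval a.
Proof. by case: k a => [a|[a b]] /=; rewrite ?normr_ge0 ?sqrtr_ge0. Qed.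

Lemma absval_eq0 k (a : scalar_field R k) : absval a = 0 -> a = 0.
Proof.
by case: k a => /= a; [move/eqP; rewrite normr_eq0 => /eqP|
  exact: ComplexField.Normc.eq0_normc].
Qed.

Lemma absval_gt0 k (a : scalar_field R k) : a != 0 -> 0 < absval a.
Proof.
move=> a0; rewrite lt_neqAle absval_ge0 andbT eq_sym.
by apply: contra a0 => /eqP/absval_eq0 ->.
Qed.

Lemma absvalM k (a b : scalar_field R k) : absval (a * b) = absval a * absval b.
Proof.
by case: k a b => a b /=; [exact: normrM|exact: ComplexField.Normc.normcM].
Qed.

Lemma absvalD k (a b : scalar_field R k) :
  absval (a + b) <= absval a + absval b.
Proof. by case: k a b => a b /=; [exact: ler_normD|exact: le_normcD]. Qed.

Lemma absval_of_real k r : absval (of_real k r) = `|r|.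
Proof. by case: k => //=; rewrite expr0n /= addr0 sqrtr_sqr. Qed.

(** Squaring isolates the first-order term in [real_part a]; the quadratic remainder is the source
    of the exponent 2. *)
Lemma absval_of_realD k r (a : scalar_field R k) :
  absval (of_real k r + a) ^+ 2 = r ^+ 2 + 2 * r * real_part a + absval a ^+ 2.
Proof.
case: k a => [a|[a b]] /=; first by rewrite !real_normK ?num_real//; ring.
by rewrite !sqr_sqrtr ?addr_ge0 ?sqr_ge0//; ring.
Qed.

Lemma real_part_le_absval k (a : scalar_field R k) : `|real_part a| <= absval a.
Proof.
case: k a => [a|[a b]] //=; rewrite -sqrtr_sqr ler_sqrt ?lerDl ?sqr_ge0//.
by rewrite addr_ge0 ?sqr_ge0.
Qed.

Lemma absval0 k : absval (0 : scalar_field R k) = 0.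
Proof. by rewrite -(rmorph0 (of_real k)) absval_of_real normr0. Qed.

Lemma absval1 k : absval (1 : scalar_field R k) = 1.
Proof. by rewrite -(rmorph1 (of_real k)) absval_of_real normr1. Qed.

Lemma absvalN k (a : scalar_field R k) : absval (- a) = absval a.
Proof.
rewrite -mulN1r absvalM -(rmorph1 (of_real k)) -rmorphN absval_of_real.
by rewrite normrN normr1 mul1r.
Qed.

Lemma absvalV k (a : scalar_field R k) : absval a^-1 = (absval a)^-1.
Proof.
have [->|a0] := eqVneq a 0.
  by rewrite invr0 absval0 invr0.
have na0 : absval a != 0 by rewrite gt_eqF ?absval_gt0.
by apply: (mulfI na0); rewrite -absvalM !mulfV// absval1.
Qed.

Lemma absval_sum k (I : Type) (s : seq I) (F : I -> scalar_field R k) :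
  absval (\sum_(i <- s) F i) <= \sum_(i <- s) absval (F i).
Proof.
elim/big_ind2: _ => // [|a x b y ax bY]; last first.
  exact: le_trans (absvalD _ _) (lerD ax bY).
by rewrite absval0.
Qed.

Lemma phase_exists k (a : scalar_field R k) :
  exists2 u, absval u = 1 & u * a = of_real k (absval a).
Proof.
have [->|a0] := eqVneq a 0.
  exists 1; first exact: absval1.
  by rewrite mulr0 absval0 rmorph0.
have na0 : absval a != 0 by rewrite gt_eqF ?absval_gt0.
exists (of_real k (absval a) * a^-1); last by rewrite divfK.
by rewrite absvalM absval_of_real absvalV ger0_norm ?absval_ge0// divff.
Qed.

(* Over the complex numbers, [x |-> u x - i u (i x)] has real part [u]. *)
Lemma scalar_of_real_part k (X : lmodType (scalar_field R k)) (u : X -> R) :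
  (forall x y, u (x + y) = u x + u y) ->
  (forall r x, u (of_real k r *: x) = r * u x) ->
  exists g : {scalar X}, forall x, real_part (g x) = u x.
Proof.
case: k X u => X u uD uZ.
  have lu : scalar u by move=> r x y; rewrite uD uZ.
  pose g : {scalar X} := HB.pack (u : X -> R) (GRing.isLinear.Build _ _ _ _ u lu).
  by exists g.
pose I : R[i] := Complex 0 1.
pose h x : R[i] := Complex (u x) (- u (I *: x)).
have lh : scalar (h : X -> R[i]).
  move=> [a b] x y; rewrite /h !scalerDr !uD !scalerA.
  have e (c d : R) w : u (Complex c d *: w) = c * u w + d * u (I *: w).
    have -> : Complex c d = Complex c 0 + Complex d 0 * I.
      by rewrite /I; congr Complex => /=; ring.
    by rewrite scalerDl uD -scalerA !uZ.
  rewrite (e a b).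
  have -> : I * Complex a b = Complex (- b) a.
    by rewrite /I; congr Complex => /=; ring.
  rewrite (e (- b) a).
  transitivity (Complex (a * u x + b * u (I *: x) + u y)
    (a * - u (I *: x) + b * u x - u (I *: y))).
    by congr Complex => /=; ring.
  by congr Complex => /=; ring.
pose g : {scalar X} := HB.pack (h : X -> R[i]) (GRing.isLinear.Build _ _ _ _ h lh).
by exists g.
Qed.

End Scalars.

(** * Sublinear functionals *)

Section Sublinear.
Variables (R : realType) (V : lmodType R).
Implicit Types (p q : V -> R) (x y v : V).

(** Homogeneity is asked only as an inequality for positive factors; equality follows by applying it
    to the inverse factor. *)
Definition sublinear p :=
  (forall x y, p (x + y) <= p x + p y) /\
  (forall a x, 0 < a -> p (a *: x) <= a * p x).

Lemma sublinear0 p : sublinear p -> p 0 = 0.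
Proof.
move=> [pD pZ]; have := pD 0 0; rewrite addr0 => p0.
by have := pZ 2 0 ltac:(lra); have := pZ 2^-1 0 ltac:(lra); rewrite !scaler0; lra.
Qed.

Lemma sublinearZ p a x : sublinear p -> 0 <= a -> p (a *: x) = a * p x.
Proof.
move=> sp; rewrite le_eqVlt => /predU1P[<-|a0].
  by rewrite scale0r mul0r sublinear0.
apply/eqP; rewrite eq_le sp.2//= -ler_pdivlMl//.
have := sp.2 a^-1 (a *: x); rewrite invr_gt0 => /(_ a0).
by rewrite scalerA mulVf ?scale1r ?gt_eqF.
Qed.

Lemma sublinear_ge p x : sublinear p -> - p (- x) <= p x.
Proof. by move=> sp; have := sp.1 x (- x); rewrite subrr sublinear0//; lra. Qed.

(** The witness is [q x], the infimum over [t >= 0] of [p (x + t v) - t p v]: the choice [t = 0]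
    gives [q <= p], and [t = 1] at [- v] gives the last bound. *)
Lemma sublinear_shrink p v : sublinear p ->
  exists q, [/\ sublinear q, forall x, q x <= p x & q (- v) <= - p v].
Proof.
move=> sp; have [pD pZ] := sp.
pose A x := [set p (x + t *: v) - t * p v | t in [set t | 0 <= t]].
(* Subadditivity on [t v = (x + t v) + (- x)] keeps the infimum finite. *)
have A_lb x : lbound (A x) (- p (- x)).
  move=> _ [t /= t0 <-]; have := pD (x + t *: v) (- x).
  by rewrite addrAC subrr add0r (sublinearZ _ sp t0); lra.
have A_has x : has_inf (A x).
  by split; [exists (p (x + 0 *: v) - 0 * p v); exists 0 => /= |exists (- p (- x))].
have q_le x t : 0 <= t -> inf (A x) <= p (x + t *: v) - t * p v.
  by move=> t0; apply: ge_inf; [case: (A_has x)|exists t].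
have q_ge x c :
    (forall t, 0 <= t -> c <= p (x + t *: v) - t * p v) -> c <= inf (A x).
  move=> h; apply: lb_le_inf; first by case: (A_has x).
  by move=> _ [t t0 <-]; exact: h.
exists (fun x => inf (A x)); split.
- split=> [x y|a x a0].
    rewrite -lerBlDr; apply: (q_ge _ _) => s s0; rewrite lerBlDr -lerBlDl.
    apply: (q_ge _ _) => t t0; rewrite lerBlDl.
    apply: le_trans (q_le _ _ (addr_ge0 s0 t0)) _.
    have := pD (x + s *: v) (y + t *: v).
    by rewrite addrACA -scalerDl; lra.
  rewrite -ler_pdivrMl//; apply: (q_ge _ _) => t t0; rewrite ler_pdivrMl//.
  apply: le_trans (q_le _ _ (mulr_ge0 (ltW a0) t0)) _.
  by rewrite -scalerA -scalerDr (sublinearZ _ sp (ltW a0)) mulrBr mulrA.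
- by move=> x; have := q_le x 0 (lexx _); rewrite scale0r addr0 mul0r subr0.
- have := q_le (- v) 1 ler01.
  by rewrite scale1r addNr sublinear0// mul1r add0r.
Qed.

(** Oddness gained at earlier vectors survives later shrinking:
    [q' (- w) <= q (- w) <= - q w <= - q' w]. *)
Lemma sublinear_shrink_seq p (s : seq V) : sublinear p ->
  exists q, [/\ sublinear q, forall x, q x <= p x &
    forall v, v \in s -> q (- v) <= - q v].
Proof.
move=> sp; elim: s => [|v s [q [sq qp qs]]]; first by exists p; split.
have [q' [sq' q'q q'v]] := sublinear_shrink v sq.
exists q'; split=> // [x|w]; first exact: le_trans (q'q x) (qp x).
rewrite inE => /predU1P[->|/qs qw].
  by have := q'q v; lra.
by have := q'q w; have := q'q (- w); lra.
Qed.

(** For an odd function, subadditivity at [- x] and [- y] is superadditivity at [x] and [y]. *)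
Lemma sublinear_odd_linear q : sublinear q -> (forall x, q (- x) <= - q x) ->
  scalar q.
Proof.
move=> sq qN.
have qNE x : q (- x) = - q x.
  by apply/eqP; rewrite eq_le qN/=; have := sublinear_ge x sq; lra.
have qD x y : q (x + y) = q x + q y.
  apply/eqP; rewrite eq_le sq.1/=; have := sq.1 (- x) (- y).
  by rewrite -opprD !qNE; lra.
move=> a x y; rewrite qD; congr (_ + _).
have [a0|a0] := leP 0 a; first exact: sublinearZ.
by rewrite -[a]opprK scaleNr qNE sublinearZ ?oppr_ge0 ?ltW// -mulNr.
Qed.

End Sublinear.

(* Shrinking along [w] and then along a basis makes [p] odd, hence linear, while
   keeping its value at [w]. *)
Lemma hahn_banach_norming (R : realType) (V : vectType R) (p : V -> R) (w : V) :
  sublinear p ->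
  exists u : V -> R, [/\ scalar u, forall x, u x <= p x & u w = p w].
Proof.
move=> sp; have [q [sq qp qw]] := sublinear_shrink w sp.
have [u [su uq us]] := sublinear_shrink_seq (vbasis {:V}) sq.
(* The vectors at which [u] is odd are closed under sums and multiples, so a basis suffices. *)
have sym_add x y :
    u (- x) <= - u x -> u (- y) <= - u y -> u (- (x + y)) <= - u (x + y).
  by move=> ux uy; have := su.1 (- x) (- y); have := su.1 x y; rewrite -opprD; lra.
have sym_scale a x : u (- x) <= - u x -> u (- (a *: x)) <= - u (a *: x).
  move=> ux; have [a0|a0] := leP 0 a.
    by rewrite -scalerN !(sublinearZ _ su a0) -mulrN ler_wpM2l.
  have a1 : 0 <= - a by rewrite oppr_ge0 ltW.
  rewrite -scaleNr (sublinearZ _ su a1).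
  have -> : a *: x = (- a) *: (- x) by rewrite scalerN scaleNr opprK.
  rewrite (sublinearZ _ su a1) -mulrN ler_wpM2l//.
  by lra.
have sym x : u (- x) <= - u x.
  rewrite (coord_vbasis (memvf x)); elim/big_ind: _ => //.
    by rewrite oppr0 sublinear0// oppr0.
  by move=> i _; apply: sym_scale; apply: us; rewrite mem_nth ?size_tuple.
have lu := sublinear_odd_linear su sym.
exists u; split=> // [x|]; first exact: le_trans (uq x) (qp x).
(* Here [u w >= - u (- w) >= - q (- w) >= p w], the last inequality coming from the shrinking along
   [w]. *)
apply/eqP; rewrite eq_le (le_trans (uq w) (qp w))/=.
have := sublinear_ge w su; have := sym w; have := uq (- w); lra.
Qed.

(** * Norms and functionals on row vectors *)

Lemma lipschitz_norm_continuous (R : realType) (V : normedModType R) (C : R)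
    (g : V -> R) :
  0 <= C -> (forall x y, `|g x - g y| <= C * `|x - y|) -> continuous g.
Proof.
move=> C0 gB x; apply/cvgrPdist_le => e e0; near=> y.
apply: le_trans (gB _ _) _.
rewrite (le_trans (ler_wpM2r (normr_ge0 _) (_ : C <= C + 1))) ?lerDl//.
rewrite -ler_pdivlMl; last by rewrite ltr_wpDl.
near: y; apply: cvgr_dist_le; first exact: cvg_id.
by rewrite mulr_gt0 ?invr_gt0 ?ltr_wpDl.
Unshelve. all: by end_near. Qed.

(** * Comparison of real seminorms with the sup norm *)

Section RealSeminorm.
Variables (R : realType) (m : nat) (g : 'rV[R]_m -> R).
Hypothesis gD : forall x y, g (x + y) <= g x + g y.
Hypothesis gZ : forall a x, g (a *: x) = `|a| * g x.

Lemma real_seminorm_ge0 x : 0 <= g x.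
Proof.
have := gD x (- x); rewrite subrr -(scale0r x) -scaleN1r !gZ normr0 normrN normr1.
by lra.
Qed.

Lemma coord_le_norm (v : 'rV[R]_m) j : `|v 0 j| <= `|v|.
Proof.
rewrite [leRHS]/Num.norm /= mx_normrE.
by apply/bigmax_geP; right; exists (0, j).
Qed.

Lemma real_seminorm_le_norm : exists2 C, 0 <= C & forall v, g v <= C * `|v|.
Proof.
exists (\sum_j g (delta_mx 0 j)) => [|v].
  by apply: sumr_ge0 => j _; exact: real_seminorm_ge0.
rewrite {1}(row_sum_delta v) mulr_suml.
elim/big_ind2: _ => [|x1 x2 y1 y2 h1 h2|j _].
- by rewrite -(scale0r 0) gZ normr0 mul0r.
- exact: le_trans (gD _ _) (lerD h1 h2).
- by rewrite gZ mulrC ler_wpM2l ?real_seminorm_ge0 ?coord_le_norm.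
Qed.

Lemma real_seminorm_continuous : continuous g.
Proof.
have [C C0 gC] := real_seminorm_le_norm.
apply: (@lipschitz_norm_continuous _ _ C) => // x y.
rewrite ler_norml; apply/andP; split.
  have := gD x (y - x); have := gC (y - x).
  by rewrite [x + (y - x)]addrC subrK distrC; lra.
by have := gD y (x - y); have := gC (x - y); rewrite [y + (x - y)]addrC subrK; lra.
Qed.

(** The constant is the minimum of [g] on the compact unit sphere; homogeneity carries the bound to
    all vectors. *)
Lemma real_norm_ge_norm : (forall v, g v = 0 -> v = 0) ->
  exists2 c, 0 < c & forall v, c * `|v| <= g v.
Proof.
move=> g0; pose A : set 'rV[R]_m := [set v | `|v| = 1].
(* If the unit sphere is empty, 0 is the only vector and any constant works. *)
have [[w Aw]|A0] := pselect (A !=set0); last first.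
  exists 1 => // v; have [->|v0] := eqVneq v 0.
    by rewrite normr0 mulr0 real_seminorm_ge0.
  exfalso; apply: A0; exists (`|v|^-1 *: v).
  by rewrite /A /= normrZ normfV normr_id mulVf ?normr_eq0.
have cA : compact A.
  apply: bounded_closed_compact.
    by exists 1; split=> // M M1 v; rewrite /A /= => ->; exact: ltW.
  rewrite (_ : A = Num.norm @^-1` [set x : R | x = 1]); last by [].
  by apply: preimage_closed; [move=> x _; exact: norm_continuous|exact: closed_eq].
have [c cA' cmin] := EVT_min_rV (ex_intro _ w Aw) cA
  (continuous_subspaceT real_seminorm_continuous).
have c1 : `|c| = 1 by move: cA'; rewrite inE.
exists (g c) => [|v].
  rewrite lt_neqAle real_seminorm_ge0 andbT; apply/eqP => gc.
  by move: c1; rewrite (g0 c) -?gc// normr0 => /eqP; rewrite eq_sym oner_eq0.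
have [->|v0] := eqVneq v 0.
  by rewrite normr0 mulr0 real_seminorm_ge0.
have nv : 0 < `|v| by rewrite normr_gt0.
have := cmin (`|v|^-1 *: v); rewrite inE /A /= normrZ normfV normr_id mulVf ?gt_eqF//.
move=> /(_ erefl); rewrite gZ normfV normr_id.
by rewrite ler_pdivlMl// mulrC.
Qed.

End RealSeminorm.

(** Carries real Hahn-Banach and real compactness over to both scalar fields. The factor 2 comes
    from bounding a modulus by the absolute values of its real and imaginary parts. *)
Lemma real_coordinates (R : realType) (k : scalar_kind) n :
  exists (m : nat) (T : 'rV[R]_m -> 'rV[scalar_field R k]_n),
    [/\ forall v w, T (v + w) = T v + T w,
        forall r v, T (r *: v) = of_real k r *: T v,
        injective T, forall x, exists v, T v = x &
        forall v j, absval (T v 0 j) <= 2 * `|v|].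
Proof.
case: k.
  exists n, id; split=> //= [x|v j]; first by exists x.
  by have := coord_le_norm v j; have := normr_ge0 v; lra.
pose T (v : 'rV[R]_(n + n)) : 'rV[R[i]]_n :=
  \row_j Complex (lsubmx v 0 j) (rsubmx v 0 j).
exists (n + n)%N, T; split=> [v w|r v|v w e|x|v j].
- by apply/rowP => j; rewrite !mxE.
- apply/rowP => j; rewrite !mxE; congr Complex; rewrite ?mxE /=; ring.
- rewrite -(hsubmxK v) -(hsubmxK w).
  have e' j : T v 0 j = T w 0 j by rewrite e.
  by congr row_mx; apply/rowP => j; have := e' j; rewrite /T [LHS]mxE [RHS]mxE => -[].
- exists (row_mx (\row_j complex.Re (x 0 j)) (\row_j complex.Im (x 0 j))).
  by apply/rowP => j; rewrite /T row_mxKl row_mxKr !mxE; case: (x 0 j).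
- have := coord_le_norm v (lshift n j); have := coord_le_norm v (rshift n j).
  rewrite /T !mxE; move: (v 0 (rshift n j)) (v 0 (lshift n j)) => a b ha hb.
  have -> : Complex b a = of_real ComplexScalars b + Complex 0 a.
    by congr Complex => /=; ring.
  have := absvalD (of_real ComplexScalars b) (Complex 0 a : scalar_field R ComplexScalars).
  rewrite absval_of_real /= expr0n /= !add0r sqrtr_sqr; lra.
Qed.

(** * Norming functionals and boundedness over either scalar field *)

Section Functionals.
Variables (R : realType) (k : scalar_kind) (n : nat).
Local Notation K := (scalar_field R k).
Local Notation X := 'rV[K]_n.

(** A real functional dominated by [p] and norming [w] is obtained in real coordinates, pulled back,
    and taken as the real part of [g]. *)
Lemma hahn_banach_seminorm (p : X -> R) (w : X) :
  (forall x y, p (x + y) <= p x + p y) ->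
  (forall a x, p (a *: x) = absval a * p x) ->
  exists2 g : {scalar X}, forall x, absval (g x) <= p x & absval (g w) = p w.
Proof.
move=> pD pZ; have [m [T [TD TZ Ti Ts _]]] := real_coordinates R k n.
have [w' w'E] := Ts w.
have sp : sublinear (p \o T).
  split=> [v v'|r v r0] /=; first by rewrite TD.
  by rewrite TZ pZ absval_of_real gtr0_norm.
have [u [ul up uw]] := hahn_banach_norming w' sp.
pose S x := sval (cid (Ts x)).
have TS x : T (S x) = x by rewrite /S; case: cid.
have uD (v v' : 'rV_m) : u (v + v') = u v + u v'.
  by have := ul 1 v v'; rewrite scale1r mul1r.
have uZ r (v : 'rV_m) : u (r *: v) = r * u v.
  have u0 : u 0 = 0 by have := uD 0 0; rewrite addr0; lra.
  by have := ul r v 0; rewrite !addr0 u0 addr0.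
have [||g gE] := @scalar_of_real_part R k X (u \o S).
- by move=> x y /=; rewrite -uD; congr u; apply: Ti; rewrite TD !TS.
- by move=> r x /=; rewrite -uZ; congr u; apply: Ti; rewrite TZ !TS.
have gp x : absval (g x) <= p x.
  (* Rotating [x] makes [g] real and nonnegative there, so the bound on the real part bounds the
     modulus. *)
  have [c c1 cE] := phase_exists (g x).
  have := up (S (c *: x)); rewrite /= TS pZ c1 mul1r.
  have := gE (c *: x); rewrite /= => <-.
  by rewrite linearZ /= cE real_part_of_real.
exists g => //; apply/eqP; rewrite eq_le gp /=.
have := real_part_le_absval (g w); rewrite gE /= => /(le_trans (ler_norm _)).
suff -> : S w = w' by rewrite uw /= w'E.
by apply: Ti; rewrite TS.
Qed.

Variable N : X -> R.
Hypothesis N_norm : is_norm N.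

Lemma norm_ge0 x : 0 <= N x.
Proof.
have [_ ND NZ] := N_norm; have := ND x (- x).
by rewrite subrr -(scale0r x) -scaleN1r !NZ absvalN absval1 absval0; lra.
Qed.

Lemma coord_bounded :
  exists2 C : R, 0 < C & forall (x : X) j, absval (x 0 j) <= C * N x.
Proof.
have [N0 ND NZ] := N_norm; have [m [T [TD TZ Ti Ts Tb]]] := real_coordinates R k n.
have T0 : T 0 = 0 by have := TZ 0 0; rewrite scale0r rmorph0 scale0r.
have [v w|r v|v /N0 Tv|c c0 Nc] := @real_norm_ge_norm R m (N \o T).
- by rewrite /= TD.
- by rewrite /= TZ NZ absval_of_real.
- by apply: Ti; rewrite T0.
exists (2 / c) => [|x j]; first by rewrite divr_gt0.
have [v <-] := Ts x; apply: le_trans (Tb v j) _.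
by have := Nc v; rewrite /= mulrC -ler_pdivlMr//; nra.
Qed.

Lemma scalar_bounded (g : {scalar X}) :
  exists2 C : R, 0 < C & forall x, absval (g x) <= C * N x.
Proof.
have [C C0 CN] := coord_bounded.
exists (1 + \sum_j C * absval (g (delta_mx 0 j))) => [|x].
  by rewrite ltr_wpDr// sumr_ge0// => j _; rewrite mulr_ge0 ?absval_ge0 ?ltW.
rewrite {1}(row_sum_delta x) linear_sum (le_trans (absval_sum _ _))//.
rewrite mulrDl mul1r ler_wpDl ?norm_ge0// mulr_suml ler_sum// => j _.
by rewrite linearZ /= absvalM mulrAC ler_wpM2r ?absval_ge0 ?CN.
Qed.

End Functionals.

(** * The strong uniqueness estimate *)

Section StrongUniqueness.
Variables (R : realType) (k : scalar_kind) (n : nat).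
Local Notation K := (scalar_field R k).
Local Notation X := 'rV[K]_n.
Variable N : X -> R.
Hypothesis N_norm : is_norm N.

(** Some 2 by 2 minor of [w] and [y] is nonzero. It does not change when a multiple of [y] is added
    to [w], and it is at most a constant times [N (w + t *: y)]. *)
Lemma distance_to_line_pos (y w : X) : y != 0 -> (forall t, w != t *: y) ->
  exists2 c, 0 < c & forall t, c <= N (w + t *: y).
Proof.
move=> y0 wy; have [C C0 CN] := coord_bounded N_norm.
have /rV0Pn[j yj] := y0.
have [i wi] : exists i, w 0 i * y 0 j - w 0 j * y 0 i != 0.
  apply: contrapT => wi; move: (wy (w 0 j / y 0 j)) => /eqP; apply.
  apply/rowP => i; rewrite mxE mulrAC; apply: (mulIf yj); rewrite divfK//.
  by apply/eqP; rewrite -subr_eq0; apply/negP => /negP h; apply: wi; exists i.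
set A := C * (absval (y 0 i) + absval (y 0 j)).
have A0 : 0 < A by rewrite mulr_gt0// ltr_wpDl ?absval_ge0 ?absval_gt0.
exists (absval (w 0 i * y 0 j - w 0 j * y 0 i) / A) => [|t].
  by rewrite divr_gt0 ?absval_gt0.
rewrite ler_pdivrMr//.
have -> : w 0 i * y 0 j - w 0 j * y 0 i =
    (w + t *: y) 0 i * y 0 j - (w + t *: y) 0 j * y 0 i by rewrite !mxE; ring.
apply: le_trans (absvalD _ _) _; rewrite absvalN !absvalM /A.
have := ler_wpM2r (absval_ge0 (y 0 j)) (CN (w + t *: y) i).
have := ler_wpM2r (absval_ge0 (y 0 i)) (CN (w + t *: y) j).
by lra.
Qed.

(** The norm of the quotient by the line of [y], pulled back to [X]. *)
Definition quotient_seminorm (y x : X) : R := inf [set N (x + t *: y) | t in [set: K]].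

Lemma quotient_seminorm_le y x t : quotient_seminorm y x <= N (x + t *: y).
Proof.
by apply: ge_inf; [exists 0 => _ [s _ <-]; exact: norm_ge0|exists t].
Qed.

Lemma le_quotient_seminorm y x c :
  (forall t, c <= N (x + t *: y)) -> c <= quotient_seminorm y x.
Proof.
move=> h; apply: lb_le_inf; first by exists (N (x + 0 *: y)); exists 0.
by move=> _ [t _ <-].
Qed.

Lemma quotient_seminormD y u v :
  quotient_seminorm y (u + v) <= quotient_seminorm y u + quotient_seminorm y v.
Proof.
have [_ ND _] := N_norm.
rewrite -lerBlDr; apply: le_quotient_seminorm => s; rewrite lerBlDr -lerBlDl.
apply: le_quotient_seminorm => t; rewrite lerBlDl.
apply: le_trans (quotient_seminorm_le y _ (s + t)) _.
by rewrite scalerDl addrACA.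
Qed.

Lemma quotient_seminormZ y a v :
  quotient_seminorm y (a *: v) = absval a * quotient_seminorm y v.
Proof.
have [_ _ NZ] := N_norm.
have le (b : K) u : b != 0 ->
    quotient_seminorm y (b *: u) <= absval b * quotient_seminorm y u.
  move=> /absval_gt0 nb; rewrite -ler_pdivrMl//.
  apply: le_quotient_seminorm => t; rewrite ler_pdivrMl//.
  apply: le_trans (quotient_seminorm_le y _ (b * t)) _.
  by rewrite -scalerA -scalerDr NZ.
have [->|a0] := eqVneq a 0.
  rewrite scale0r absval0 mul0r; apply/eqP; rewrite eq_le; apply/andP; split.
    apply: le_trans (quotient_seminorm_le y 0 0) _.
    by rewrite scale0r addr0 -(scale0r 0) NZ absval0 mul0r.
  by apply: le_quotient_seminorm => t; exact: norm_ge0.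
apply/eqP; rewrite eq_le le//=.
rewrite -ler_pdivlMl ?absval_gt0//.
have := le a^-1 (a *: v); rewrite invr_eq0 => /(_ a0).
by rewrite scalerA mulVf// scale1r absvalV.
Qed.

(* [g] norms [w] for the distance to the line of [y]; [t > 0] because the distance
   need not be known to be attained. *)
Lemma almost_orthogonal_vector (y w : X) (t : R) :
  y != 0 -> (forall a, w != a *: y) -> 0 < t ->
  exists y1 (g : {scalar X}) a b,
    [/\ w = a *: y + b *: y1, y1 = b^-1 *: (w - a *: y), g y = 0, g y1 = 1 &
      (forall x, absval (g x) <= N x) /\ N y1 <= 1 + t].
Proof.
move=> y0 wy t0; have [N0 ND NZ] := N_norm.
have [g gq gw] := hahn_banach_seminorm w (quotient_seminormD y) (quotient_seminormZ y).
have [c c0 cN] := distance_to_line_pos y0 wy.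
set d := quotient_seminorm y w in gw.
have d0 : 0 < d by apply: lt_le_trans c0 _; exact: le_quotient_seminorm.
have gN x : absval (g x) <= N x.
  apply: le_trans (gq x) _; have := quotient_seminorm_le y x 0.
  by rewrite scale0r addr0.
have gy : g y = 0.
  apply: absval_eq0; apply/eqP; rewrite eq_le absval_ge0 andbT.
  apply: le_trans (gq y) _; apply: le_trans (quotient_seminorm_le y y (-1)) _.
  by rewrite scaleN1r subrr -(scale0r 0) NZ absval0 mul0r.
have gw0 : g w != 0.
  by apply/eqP => h; move: gw d0; rewrite h absval0 => <-; rewrite ltxx.
(* A nearly optimal [s]: after division by [g w], of modulus [d], the vector has norm at most
   [1 + t]. *)
have [s sN] : exists s, N (w + s *: y) < d * (1 + t).
  apply: contrapT => h; have : d * (1 + t) <= d.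
    apply: le_quotient_seminorm => s; rewrite leNgt.
    by apply/negP => ?; apply: h; exists s.
  by nra.
exists ((g w)^-1 *: (w + s *: y)), g, (- s), (g w); split=> //.
- by rewrite scalerA mulfV// scale1r scaleNr addrCA addNr addr0.
- by rewrite scaleNr opprK.
- by rewrite linearZ linearD linearZ /= gy mulr0 addr0 mulVf.
- split=> //; rewrite NZ absvalV gw ler_pdivrMl//; exact: ltW.
Qed.

(* An approximate Kolmogorov criterion. *)
Lemma near_extremal_pair (P : {linear X -> X}) (f : {scalar X})
    (L F : R) (y : X) (e : R) :
  1 < L -> 0 <= F -> (forall x, absval (f x) <= F * N x) ->
  (forall x, N (P x) <= L * N x) ->
  (forall s d : R, 0 < d ->
    exists2 x, N x <= 1 & L - d < N (P x + f x *: (of_real k s *: y))) ->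
  0 < e ->
  exists x (g : {scalar X}) a,
    [/\ N x <= 1, forall v, absval (g v) <= N v, g (P x) = of_real k a,
      L - e <= a <= L & - e <= real_part (f x * g y)].
Proof.
move=> L1 F0 fF PL Pmin e0; have [N0 ND NZ] := N_norm.
pose B := F * N y; have B0 : 0 <= B by rewrite mulr_ge0 ?norm_ge0.
pose e' := Num.min e (Num.min 1 (L - 1)).
have [e'0 e'e e'1 e'L] : [/\ 0 < e', e' <= e, e' <= 1 & e' <= L - 1].
  by rewrite /e' !lt_min !ge_min e0 ltr01 subr_gt0 L1 !lexx ?orbT.
(* In [D], the part [2 * L + B ^+ 2] pays for the second-order terms of the squared norm, and
   [B + 1] for the bound [L - e' <= a]. *)
pose D := 2 * L + B ^+ 2 + B + 1.
have D1 : 1 <= D by rewrite /D; nra.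
pose s := e' / D.
have s0 : 0 < s by rewrite divr_gt0//; lra.
have sD : s * D = e' by rewrite /s divfK// gt_eqF//; lra.
have s1 : s <= 1 by rewrite /s ler_pdivrMr; lra.
(* The slack is of order [s ^+ 2], so that it is still of order [s] after division by the step
   [s]. *)
have [|x x1 xP] := Pmin s (s ^+ 2); first by rewrite exprn_gt0.
have [g gN gx] :=
  hahn_banach_seminorm (P x + f x *: (of_real k s *: y)) ND NZ.
(* Replacing [x] by [u *: x] makes [g (P x)] real and nonnegative. *)
have [u u1 uE] := phase_exists (g (P x)).
set a := absval (g (P x)) in uE.
pose b := f (u *: x) * g y.
have aL : a <= L.
  apply: le_trans (gN _) _; apply: le_trans (PL x) _.
  by have := norm_ge0 N_norm x; nra.
have a0 : 0 <= a by exact: absval_ge0.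
have bB : absval b <= B.
  rewrite /b linearZ /= !absvalM u1 mul1r /B.
  apply: ler_pM; rewrite ?absval_ge0//.
  apply: le_trans (fF x) _; have := norm_ge0 N_norm x; nra.
have v2 : N (P x + f x *: (of_real k s *: y)) ^+ 2 =
    a ^+ 2 + 2 * a * (s * real_part b) + s ^+ 2 * absval b ^+ 2.
  rewrite -gx -[absval _]mul1r -[X in X * _]u1 -absvalM linearD !linearZ /= mulrDr uE.
  have -> : u * (f x * (of_real k s * g y)) = of_real k s * b.
    by rewrite /b linearZ /=; ring.
  by rewrite absval_of_realD real_partMr absvalM absval_of_real gtr0_norm// exprMn.
have b0 := absval_ge0 b.
have v1 : N (P x + f x *: (of_real k s *: y)) <= a + s * B.
  rewrite -gx linearD !linearZ /=; apply: le_trans (absvalD _ _) _.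
  rewrite lerD2l mulrCA absvalM absval_of_real gtr0_norm// ler_pM2l//.
  by move: bB; rewrite /b linearZ /= -mulrA absvalM u1 mul1r.
set v := N (P x + _) in xP v1 v2.
have sB : s ^+ 2 + s * B <= e'.
  by rewrite -sD /D; nra.
have a1 : 1 <= a by lra.
exists (u *: x), g, a; split=> //.
- by rewrite NZ u1 mul1r.
- by rewrite !linearZ /= uE.
- by apply/andP; split=> //; lra.
- rewrite -/b.
  (* Comparing [(L - s ^+ 2) ^+ 2 <= v ^+ 2] with the expansion [v2], where [a <= L] and
     [absval b <= B], leaves only errors of order [s ^+ 2] beside the first-order term. *)
  have h : s * (- s * (2 * L + B ^+ 2)) <= s * (2 * a * real_part b).
    have b2 : absval b ^+ 2 <= B ^+ 2 by rewrite lerXn2r ?nnegrE.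
    have a2 : a ^+ 2 <= L ^+ 2 by rewrite lerXn2r ?nnegrE//; lra.
    have v3 : (L - s ^+ 2) ^+ 2 <= v ^+ 2.
      rewrite lerXn2r ?nnegrE//; [nra|exact: norm_ge0|exact: ltW].
    have s4 : 0 <= s ^+ 2 * s ^+ 2 by rewrite mulr_ge0 ?sqr_ge0.
    have : s ^+ 2 * absval b ^+ 2 <= s ^+ 2 * B ^+ 2 by rewrite ler_wpM2l ?sqr_ge0.
    nra.
  rewrite ler_pM2l// in h.
  have h2 : - (e') <= 2 * a * real_part b.
    apply: le_trans h; rewrite -sD /D; nra.
  have [r0|r0] := leP 0 (real_part b); first by lra.
  by nra.
Qed.

(** Two losses of at most [2 * L * eps]: one from replacing [L] by [a] in the square, one from the
    defect of [rho] multiplied by [2 * a]. *)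
Lemma square_increment (L a eps rho sigma : R) :
  0 <= eps -> eps <= L -> L - eps <= a -> a <= L -> sigma - eps <= rho ->
  L ^+ 2 + 2 * a * sigma <= a ^+ 2 + 2 * a * rho + 4 * L * eps.
Proof.
move=> eps0 epsL aL La rho_ge; have a0 : 0 <= a by lra.
have : (L - eps) ^+ 2 <= a ^+ 2 by rewrite lerXn2r ?nnegrE ?subr_ge0.
have := ler_wpM2l a0 rho_ge; have := ler_wpM2r eps0 La; have := sqr_ge0 eps.
by rewrite sqrrB; lra.
Qed.

(* Expanding [P x] as [al *: y + g1 (P x) *: y1] and evaluating [g] gives
   [a = al * g y + g1 x * g y1 - f x * c * g y1] with [c = g1 z], whence the bound
   on [D] when [g y] is small. *)
Lemma strong_uniqueness_bound (P : {linear X -> X}) (f : {scalar X})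
    (z : X) (L : R) :
  1 < L -> f z = 1 -> (forall x, P x = x - f x *: z) ->
  (forall x, N (P x) <= L * N x) ->
  (forall y (d : R), f y = 0 -> 0 < d ->
    exists2 x, N x <= 1 & L - d < N (P x + f x *: y)) ->
  (forall y, f y = 0 -> y != 0 -> exists w, [/\ f w = 0, forall a, w != a *: y &
    forall v, f v = 0 -> exists a b, v = a *: y + b *: w]) ->
  exists2 r : R, 0 < r & forall y (G : R), f y = 0 -> 0 <= G ->
    (forall x, N x <= 1 -> N (P x + f x *: y) <= G) ->
    L ^+ 2 + r * N y ^+ 2 <= G ^+ 2.
Proof.
move=> L1 fz PE PL Pmin Y2; have [N0 ND NZ] := N_norm.
have [F F0 fF] := scalar_bounded N_norm f.
have Nge0 := norm_ge0 N_norm.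
have Npos x : x != 0 -> 0 < N x.
  by move=> x0; rewrite lt_neqAle Nge0 andbT; apply: contra x0 => /eqP/esym/N0 ->.
have z0 : z != 0.
  by apply/eqP => zE; move: fz; rewrite zE linear0 => /eqP; rewrite eq_sym oner_eq0.
set Z := N z; have Z0 : 0 < Z by exact: Npos.
pose h := L - 1; have h0 : 0 < h by rewrite subr_gt0.
(* [L * B] will bound [N (P x) + absval (g1 (P x)) * N y1], hence [absval al * N y]; [eta] is then
   chosen so that [absval (g y) <= eta * N y] forces [absval (al * g y) <= h / 8]. *)
pose B := 2 + h / 8; have B0 : 2 < B by rewrite /B; lra.
pose eta := h / (8 * B * L); have eta0 : 0 < eta.
  by rewrite divr_gt0// !mulr_gt0//; lra.
have etaE : B * L * eta = h / 8.
  by rewrite /eta; field; apply/andP; split; rewrite gt_eqF//; lra.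
(* [C] will bound [D] in modulus, and [delta] will bound [absval (f x)] from below. *)
pose C := F * Z * (1 + h / 8); have C0 : 0 < C.
  by rewrite !mulr_gt0//; lra.
pose delta := h / (2 * Z); have delta0 : 0 < delta by rewrite divr_gt0// mulr_gt0.
have deltaE : delta * Z = h / 2 by rewrite /delta; field; rewrite gt_eqF.
pose q := (delta * eta) ^+ 2; have q0 : 0 < q by rewrite exprn_gt0// mulr_gt0.
(* With this [kappa] the tilt by [tau] costs at most half of the quadratic gain [q * N y ^+ 2] when
   [g y] is large. *)
pose kappa := q / (4 * L * C); have kappa0 : 0 < kappa.
  by rewrite divr_gt0// !mulr_gt0//; lra.
have kappaE : 4 * L * C * kappa = q.
  by rewrite /kappa; field; apply/andP; split; rewrite gt_eqF//; lra.
(* One entry for each case: [kappa * h] is gained when [g y] is small, [q / 2] when it is large. *)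
exists (Num.min (kappa * h) (q / 2)) => [|y G fy G0 GP].
  by rewrite lt_min mulr_gt0// divr_gt0.
set r := Num.min _ _.
have r1 : r <= kappa * h by rewrite /r ge_min lexx.
have r2 : r <= q / 2 by rewrite /r ge_min lexx orbT.
have [yE|y0] := eqVneq y 0.
  have -> : N y = 0 by rewrite yE -(scale0r 0) NZ absval0 mul0r.
  have LG : L <= G.
    apply/ler_addgt0Pr => e e0; have [x x1 xP] := Pmin y e fy e0.
    by have := lt_le_trans xP (GP x x1); lra.
  by rewrite expr0n /= mulr0 addr0 lerXn2r ?nnegrE//; lra.
have n0 : 0 < N y by exact: Npos.
have [w [fw wy span_y]] := Y2 y fy y0.
have [|y1 [g1 [a0 [b0 [wE y1E g1y g1y1 [g1N Ny1]]]]]] :=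
  almost_orthogonal_vector (t := h / 8) y0 wy; first by rewrite divr_gt0.
have fy1 : f y1 = 0.
  by rewrite y1E linearZ linearB linearZ /= fw fy mulr0 subr0 mulr0.
(* Since [g1] vanishes at [y] and is 1 at [y1], it reads off the coordinate along [y1]. *)
have expand v : f v = 0 -> exists al, v = al *: y + g1 v *: y1.
  move=> /span_y[a [b vE]]; exists (a + b * a0).
  have {1}-> : v = (a + b * a0) *: y + (b * b0) *: y1.
    by rewrite vE wE scalerDr !scalerA scalerDl addrA.
  congr (_ + _ *: _).
  by rewrite vE wE !(linearD, linearZ) /= g1y g1y1; ring.
pose c := g1 z; pose tau := kappa * N y ^+ 2.
have tau0 : 0 < tau by rewrite mulr_gt0// exprn_gt0.
have cZ : absval c <= Z by exact: g1N.
pose y' := y + (of_real k tau * c) *: y1.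
have fy' : f y' = 0 by rewrite linearD linearZ /= fy fy1 mulr0 addr0.
(* The extremal pair depends on [eps], but [r] does not: the loss [4 * L * eps] is absorbed by an
   arbitrary [e]. *)
apply/ler_addgt0Pr => e e0.
pose eps := Num.min (h / 4) (e / (4 * L)).
have L0 : 0 < L by lra.
have eps0 : 0 < eps by rewrite lt_min !divr_gt0// mulr_gt0.
have epsh : eps <= h / 4 by rewrite ge_min lexx.
have epse : 4 * L * eps <= e.
  by rewrite mulrC -ler_pdivlMr ?mulr_gt0// ge_min lexx orbT.
have [|x [g [a [x1 gN gPx /andP[aL La] fgy']]]] :=
    near_extremal_pair (y := y') L1 (ltW F0) fF PL _ eps0.
  by move=> s d d0; apply: Pmin => //; rewrite linearZ /= fy' mulr0.
set rho := real_part (f x * g y).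
set D := real_part (f x * c * g y1).
have first_order : - eps <= rho + tau * D.
  apply: le_trans fgy' _; rewrite -real_partMr -raddfD /= le_eqVlt; apply/orP; left.
  by apply/eqP; congr real_part; rewrite linearD linearZ /=; ring.
set m := absval (g y).
have second_order : a ^+ 2 + 2 * a * rho + (absval (f x) * m) ^+ 2 <= G ^+ 2.
  have := le_trans (gN _) (GP x x1); rewrite linearD linearZ /= gPx => gG.
  by rewrite -absvalM -absval_of_realD lerXn2r ?nnegrE ?absval_ge0.
have NPx : N (P x) <= L.
  by apply: le_trans (PL x) _; rewrite -[leRHS]mulr1 ler_pM2l.
have gy1 : absval (g y1) <= 1 + h / 8 by exact: le_trans (gN _) Ny1.
have Dle (u v : K) (s t : R) : absval u <= s -> absval v <= t ->
    `|real_part (u * v)| <= s * t.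
  move=> us vt; apply: le_trans (real_part_le_absval _) _.
  by rewrite absvalM ler_pM ?absval_ge0.
have a1 : 1 <= a by move: aL epsh h0; rewrite /h; clear; lra.
have epsL : eps <= L by move: epsh L1; rewrite /h; clear; lra.
have m0 : 0 <= m by exact: absval_ge0.
have N2 : r * N y ^+ 2 <= kappa * h * N y ^+ 2.
  by rewrite ler_wpM2r ?sqr_ge0.
have N3 : r * N y ^+ 2 <= q / 2 * N y ^+ 2.
  by rewrite ler_wpM2r ?sqr_ge0.
have [m_small|m_large] := leP m (eta * N y).
  have DE : D = real_part (g1 x * g y1) - a + real_part (g (P x) - g1 (P x) * g y1).
    rewrite -[X in _ - X](real_part_of_real k) -gPx -raddfB -raddfD /=.
    congr real_part; rewrite [in g1 (P x)]PE linearB linearZ /= -/c; ring.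
  have [al PxE] : exists al, P x = al *: y + g1 (P x) *: y1.
    by apply: expand; rewrite PE linearB linearZ /= fz mulr1 subrr.
  have gE : g (P x) - g1 (P x) * g y1 = al * g y.
    by rewrite {1}PxE linearD !linearZ /= addrK.
  have alB : absval al * N y <= L * B.
    rewrite -NZ (_ : al *: y = P x + (- g1 (P x)) *: y1); last first.
      by rewrite {1}PxE scaleNr addrK.
    apply: le_trans (ND _ _) _; rewrite NZ absvalN.
    have : absval (g1 (P x)) * N y1 <= L * (1 + h / 8).
      by rewrite ler_pM ?absval_ge0// (le_trans (g1N _)).
    by move: NPx; rewrite /B; clear; lra.
  have alm : real_part (al * g y) <= h / 8.
    apply: le_trans (ler_norm _) _; apply: le_trans (real_part_le_absval _) _.
    rewrite absvalM -etaE; apply: le_trans (ler_wpM2l (absval_ge0 al) m_small) _.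
    by rewrite mulrCA [leRHS]mulrC (ler_pM2l eta0) [B * L]mulrC.
  have g1g : real_part (g1 x * g y1) <= 1 + h / 8.
    apply: le_trans (ler_norm _) _; rewrite -[leRHS]mul1r; apply: Dle => //.
    exact: le_trans (g1N x) x1.
  (* The bounds add up to [(1 + h / 8) - (L - h / 4) + h / 8 = - (h / 2)]. *)
  have Dh : D <= - (h / 2).
    by rewrite DE gE; move: epsh alm g1g aL h0; rewrite /h; clear; lra.
  have rho_ge : tau * (h / 2) - eps <= rho.
    have : tau * D <= tau * - (h / 2) by rewrite ler_pM2l.
    by move: first_order; clear; lra.
  have := square_increment (ltW eps0) epsL aL La rho_ge.
  have : tau * h <= a * (tau * h) by rewrite ler_peMl// ltW// mulr_gt0.
  have : 0 <= (absval (f x) * m) ^+ 2 by exact: sqr_ge0.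
  have : tau * h = kappa * h * N y ^+ 2 by rewrite /tau; ring.
  by move: second_order N2 epse; clear; lra.
(* [P x] has norm close to [L > 1] while [N x <= 1], so the term [f x *: z] must account for the
   difference. *)
have fxZ : delta <= absval (f x).
  rewrite -(ler_pM2r Z0) deltaE -NZ.
  have : N (P x) <= N x + N (f x *: z).
    by rewrite PE -scaleNr; apply: le_trans (ND _ _) _; rewrite !NZ absvalN.
  have : a <= N (P x).
    by have := gN (P x); rewrite gPx absval_of_real ger0_norm// (le_trans ler01).
  by move: x1 aL epsh h0; rewrite /h; clear; lra.
have Dabs : `|D| <= C.
  rewrite /D; apply: Dle => //; rewrite absvalM ler_pM ?absval_ge0//.
  by apply: le_trans (fF x) _; rewrite -[leRHS]mulr1 ler_pM2l.
have rho_ge : - (tau * C) - eps <= rho.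
  have : tau * D <= tau * C by rewrite ler_pM2l// (le_trans (ler_norm _) Dabs).
  by move: first_order; clear; lra.
have large : q * N y ^+ 2 <= (absval (f x) * m) ^+ 2.
  rewrite /q -exprMn.
  have : delta * eta * N y <= absval (f x) * m.
    rewrite -mulrA; apply: ler_pM (ltW m_large) => //; first exact: ltW.
    by rewrite mulr_ge0// ltW.
  apply: lerXn2r; rewrite nnegrE; last exact: mulr_ge0 (absval_ge0 _) m0.
  exact: mulr_ge0 (ltW (mulr_gt0 delta0 eta0)) (ltW n0).
have := square_increment (ltW eps0) epsL aL La rho_ge.
have : a * (tau * C) <= L * (tau * C) by rewrite ler_pM2r// mulr_gt0.
have : 4 * L * C * tau = q * N y ^+ 2 by rewrite -kappaE /tau; ring.
by move: second_order N3 large epse; clear; lra.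
Qed.

End StrongUniqueness.

(** * Operator norms and projections *)

Section OperatorNorm.
Variables (R : realType) (k : scalar_kind) (n : nat).
Local Notation X := 'rV[scalar_field R k]_n.
Variable N : X -> R.
Hypothesis N_norm : is_norm N.
Implicit Type T : 'End(X).

Lemma linear_bounded T : exists2 C : R, 0 < C & forall x, N (T x) <= C * N x.
Proof.
have [_ ND NZ] := N_norm; have [C C0 CN] := coord_bounded N_norm.
exists (1 + \sum_j C * N (T (delta_mx 0 j))) => [|x].
  by rewrite ltr_wpDr// sumr_ge0// => j _; rewrite mulr_ge0 ?norm_ge0 ?ltW.
rewrite {1}(row_sum_delta x) linear_sum mulrDl mul1r ler_wpDl ?norm_ge0//.
rewrite mulr_suml; elim/big_ind2: _ => [|x1 x2 y1 y2 h1 h2|j _].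
- by rewrite -(scale0r 0) NZ absval0 mul0r.
- exact: le_trans (ND _ _) (lerD h1 h2).
- by rewrite linearZ /= NZ mulrAC ler_wpM2r ?norm_ge0 ?CN.
Qed.

(** Ensures that [opnorm] is a true supremum and not the default value of [sup]. *)
Lemma opnorm_has_sup T : has_sup [set N (T x) | x in [set x | N x <= 1]].
Proof.
have [_ _ NZ] := N_norm; split.
  by exists (N (T 0)); exists 0 => //=; rewrite -(scale0r 0) NZ absval0 mul0r.
have [C C0 TC] := linear_bounded T; exists C => _ [x /= x1 <-].
by apply: le_trans (TC x) _; rewrite -[leRHS]mulr1 ler_pM2l.
Qed.

Lemma le_opnorm T x : N x <= 1 -> N (T x) <= opnorm N T.
Proof. by move=> x1; apply: ub_le_sup; [case: (opnorm_has_sup T)|exists x]. Qed.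

Lemma opnorm_le T c : (forall x, N x <= 1 -> N (T x) <= c) -> opnorm N T <= c.
Proof.
move=> h; apply: ge_sup; first by case: (opnorm_has_sup T).
by move=> _ [x x1 <-]; exact: h.
Qed.

Lemma opnorm_ge0 T : 0 <= opnorm N T.
Proof.
apply: le_trans (norm_ge0 N_norm (T 0)) (le_opnorm T _).
by have [_ _ NZ] := N_norm; rewrite -(scale0r 0) NZ absval0 mul0r.
Qed.

Lemma le_opnormM T x : N (T x) <= opnorm N T * N x.
Proof.
have [N0 _ NZ] := N_norm; have [->|x0] := eqVneq x 0.
  by rewrite linear0 -(scale0r 0) NZ absval0 !mul0r mulr0.
have Nx : 0 < N x.
  by rewrite lt_neqAle norm_ge0// andbT; apply: contra x0 => /eqP/esym/N0 ->.
have := @le_opnorm T (of_real k (N x)^-1 *: x).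
rewrite linearZ !NZ absval_of_real normfV gtr0_norm// mulVf ?gt_eqF// lexx.
by move=> /(_ isT); rewrite ler_pdivrMl// mulrC.
Qed.

Lemma opnorm_adherent T c : c < opnorm N T -> exists2 x, N x <= 1 & c < N (T x).
Proof.
move=> cT; apply: contrapT => h; have : opnorm N T <= c; last by rewrite leNgt cT.
by apply: opnorm_le => x x1; rewrite leNgt; apply/negP => ?; apply: h; exists x.
Qed.

End OperatorNorm.

(** * Planes, and projections onto hyperplanes *)

Lemma vspace_two_span (F : fieldType) (V : vectType F) (Y : {vspace V}) (y : V) :
  \dim Y = 2%N -> y \in Y -> y != 0 ->
  exists w, [/\ w \in Y, forall a, w != a *: y &
    forall v, v \in Y -> exists a b, v = a *: y + b *: w].
Proof.
move=> dY yY y0; have dy : \dim <[y]> = 1%N by rewrite dim_vline y0.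
have /subvPn[w wY wy] : ~~ (Y <= <[y]>)%VS.
  by apply/negP => /dimvS; rewrite dY dy.
exists w; split=> // [a|v].
  by apply: contra wy => /eqP ->; rewrite memvZ// memv_line.
have YE : (<[y]> + <[w]> == Y)%VS.
  rewrite eqEdim subv_add -!memvE yY wY dY /=.
  rewrite ltnNge -dy; apply: contra wy => sd.
  have : (<[y]> == <[y]> + <[w]>)%VS by rewrite eqEdim addvSl.
  by move=> /eqP ->; rewrite (subvP (addvSr _ _)) ?memv_line.
rewrite -(eqP YE) => /memv_addP[_ /vlineP[a ->] [_ /vlineP[b ->] ->]].
by exists a, b.
Qed.

(** By rank and nullity the kernel of [P] is a line; [z] spans it and [f x] is the coordinate of
    [x - P x] along it. *)
Lemma hyperplane_projection (R : realType) (k : scalar_kind) n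
    (Y : {vspace 'rV[scalar_field R k]_n.+1}) P :
  \dim Y = n -> is_projection Y P ->
  exists (f : {scalar 'rV[scalar_field R k]_n.+1}) z,
    [/\ f z = 1, forall x, P x = x - f x *: z & forall x, (x \in Y) = (f x == 0)].
Proof.
move=> dY [PY PI].
have imP : limg P = Y.
  apply/eqP; rewrite eqEsubv PY /=; apply/subvP => y yY.
  by rewrite -(PI y yY) memv_img ?memvf.
have dker : \dim (lker P) = 1%N.
  have := limg_ker_dim P fullv; rewrite capfv imP dY dimvf /dim /= mul1n.
  by move=> dE; apply: (@addIn n); rewrite dE.
pose z := vpick (lker P).
have z0 : z != 0 by rewrite vpick0 -dimv_eq0 dker.
have kerE : lker P = <[z]>%VS.
  by apply/eqP; rewrite eq_sym eqEdim -memvE memv_pick dim_vline z0 dker.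
have ex x : exists a, x - P x = a *: z.
  apply/vlineP; rewrite -kerE memv_ker linearB /= (PI (P x)) ?subrr//.
  by rewrite (subvP PY) ?memv_img ?memvf.
pose h x := sval (cid (ex x)).
have hE x : x - P x = h x *: z by rewrite /h; case: cid.
have inj a b : a *: z = b *: z -> a = b.
  move=> /eqP; rewrite -subr_eq0 -scalerBl scaler_eq0 (negbTE z0) orbF.
  by rewrite subr_eq0 => /eqP.
have lh : scalar h.
  move=> a x y; apply: inj; rewrite -hE linearP /= scalerDl -scalerA -!hE.
  by rewrite scalerBr opprD addrACA.
pose f : {scalar _} := HB.pack h (GRing.isLinear.Build _ _ _ _ h lh).
exists f, z; split=> [|x|x].
- apply: inj; rewrite -[f z *: z]hE scale1r.
  by have := memv_pick (lker P); rewrite memv_ker => /eqP ->; rewrite subr0.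
- by rewrite -[f x *: z]hE opprB addrCA subrr addr0.
- apply/idP/eqP => [xY|fx0].
    by apply: inj; rewrite -[f x *: z]hE (PI x xY) subrr scale0r.
  have := hE x; rewrite [h x]fx0 scale0r => /eqP; rewrite subr_eq0 => /eqP ->.
  by rewrite (subvP PY) ?memv_img ?memvf.
Qed.

Theorem theorem5p3 (R : realType) (k : scalar_kind)
    (N : 'rV[scalar_field R k]_3 -> R) (Y : {vspace 'rV[scalar_field R k]_3}) :
  is_norm N -> \dim Y = 2%N ->
  1 < relative_projection_constant N Y ->
  forall P : 'End('rV[scalar_field R k]_3),
    is_minimal_projection N Y P ->
    is_strongly_unique_minimal_projection 2 N Y P.
Proof.
move=> N_norm dY lam1 P [Pproj Pmin]; split=> //.
have [_ _ NZ] := N_norm.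
have [f [z [fz PE fY]]] := hyperplane_projection dY Pproj.
have min Q : is_projection Y Q -> opnorm N P <= opnorm N Q.
  move=> Qproj; rewrite Pmin; apply: ge_inf; last by exists Q.
  by exists 0 => _ [T _ <-]; exact: opnorm_ge0.
have [F F0 fF] := scalar_bounded N_norm f.
have [|y d fy d0|y fy y0|r r0 bound] :=
    strong_uniqueness_bound N_norm (P := P) (L := opnorm N P) _ fz PE
      (le_opnormM N_norm P).
- by rewrite Pmin.
(* Adding [f x *: y] with [y] in [Y] gives another projection, whose norm is at least that of [P] by
   minimality. *)
- have lT : linear (fun x => P x + f x *: y).
    by move=> a u v; rewrite !linearP /= scalerDl scalerDr scalerA addrACA.
  pose T : {linear 'rV[scalar_field R k]_3 -> 'rV[scalar_field R k]_3} :=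
    HB.pack (fun x => P x + f x *: y) (GRing.isLinear.Build _ _ _ _ _ lT).
  have Tproj : is_projection Y (linfun T).
    split; last first.
      move=> u uY; have := uY; rewrite fY => /eqP fu.
      by rewrite lfunE /= (Pproj.2 u uY) fu scale0r addr0.
    apply/subvP => _ /memv_imgP[u _ ->]; rewrite lfunE /= rpredD ?rpredZ ?fY ?fy//.
    by rewrite PE linearB linearZ /= fz mulr1 subrr.
  have [|x x1 xT] := @opnorm_adherent _ _ _ _ N_norm (linfun T) (opnorm N P - d).
    by have := min _ Tproj; lra.
  by exists x => //; rewrite lfunE in xT.
- have [|w [wY wy span]] := vspace_two_span dY _ y0; first by rewrite fY fy.
  by exists w; split=> // [|v fv]; [apply/eqP; rewrite -fY|apply: span; rewrite fY fv].
(* The bound is in terms of [N (Q z)]; dividing by [F ^+ 2] converts it, as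
   [opnorm N (Q - P) <= F * N (Q z)]. *)
exists (r / F ^+ 2) => [|Q Qproj]; first by rewrite divr_gt0// exprn_gt0.
rewrite !powR_mulrn ?opnorm_ge0//.
(* Apply [Q] to [x = P x + f x *: z]; it fixes [P x], which lies in [Y]. *)
have QE x : Q x = P x + f x *: Q z.
  rewrite -linearZ /= -[in LHS](subrK (f x *: z) x) linearD /= -PE.
  by rewrite (Qproj.2 (P x))// fY PE linearB linearZ /= fz mulr1 subrr.
have Qz : f (Q z) = 0.
  by apply/eqP; rewrite -fY (subvP Qproj.1) ?memv_img ?memvf.
have QPle : opnorm N (Q - P) <= F * N (Q z).
  apply: opnorm_le => // x x1; rewrite add_lfunE opp_lfunE (QE x) addrAC subrr add0r NZ.
  rewrite ler_wpM2r ?norm_ge0//; apply: le_trans (fF x) _.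
  by rewrite -[leRHS]mulr1 ler_pM2l.
have QPsq : r / F ^+ 2 * opnorm N (Q - P) ^+ 2 <= r * N (Q z) ^+ 2.
  rewrite mulrAC ler_pdivrMr ?exprn_gt0// -mulrA ler_pM2l// mulrC -exprMn.
  apply: lerXn2r QPle; rewrite nnegrE; first exact: opnorm_ge0.
  by rewrite mulr_ge0 ?norm_ge0// ltW.
apply: le_trans (bound _ _ Qz (opnorm_ge0 N_norm Q) _); first by rewrite lerD2l.
by move=> x x1; rewrite -(QE x) le_opnorm.
Qed.
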